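(* Every six-point Ptolemaic metric has $1$-negative type, and the exponent is sharp (for no $q>1$ does every six-point Ptolemaic metric have $q$-negative type). Hence \[ P(6)=1. \]
   Context: A metric is Ptolemaic if $d(x,y)d(z,w)\le d(x,z)d(y,w)+d(x,w)d(y,z)$ for all points $x,y,z,w$. A finite metric space $(X,d)$ has $q$-negative type if $\sum_{x,y\in X}z_xz_y\,d(x,y)^q\le 0$ whenever $\sum_x z_x=0$ ($z_x$ real). For $m\ge3$, $P(m)=\sup\{q>0:$ every Ptolemaic metric on exactly $m$ points has $q$-negative type$\}$. *)

(* Defs.v *)
From HB Require Import structures.
From mathcomp Require Import all_boot all_order all_algebra.
From mathcomp Require Import all_classical all_reals all_analysis.

Set Implicit Arguments.
Unset Strict Implicit.
Unset Printing Implicit Defensive.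

Import Order.TTheory GRing.Theory Num.Theory.

Local Open Scope classical_set_scope.
Local Open Scope ring_scope.

#[short(type="finMetricType")]
HB.structure Definition FinMetric (R : numDomainType) :=
  { X of Finite X & Metric R X }.

Definition ptolemaic (R : realType) (X : metricType R) : Prop :=
  forall x y z w : X,
    mdist x y * mdist z w <= mdist x z * mdist y w + mdist x w * mdist y z.

(* Used for q > 0 only: the diagonal terms vanish because 0 `^ q = 0 for
   q != 0, whereas 0 `^ 0 = 1. *)
Definition negative_type (R : realType) (X : finMetricType R) (q : R) : Prop :=
  forall z : X -> R, \sum_x z x = 0 ->
    \sum_x \sum_y z x * z y * mdist x y `^ q <= 0.

Definition all_ptolemaic_negative_type (R : realType) (m : nat) (q : R) : Prop :=
  forall X : finMetricType R,
    #|X| = m -> ptolemaic X -> negative_type X q.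

(* The supremum is taken in the extended reals, so that it is meaningful
   whether or not the set of exponents is empty or bounded. *)
Definition ptolemaic_exponent (R : realType) (m : nat) : \bar R :=
  ereal_sup [set q%:E | q in
    [set q : R | 0 < q /\ all_ptolemaic_negative_type m q]].

(* Main.v *)
Require Import Defs.
From HB Require Import structures.
From mathcomp Require Import all_boot all_order all_algebra.
From mathcomp Require Import all_classical all_reals all_analysis.
From mathcomp Require Import ring lra.

(* After sorting the six points by weight, the sign pattern of the weights is
   1+5, 2+4 or 3+3.  The pattern 1+5 only needs the triangle inequality.

   In the pattern 2+4 the form is quadratic in the splitting of the mass between
   the two points a, b; minimising over it leaves, for each pair of the other
   four points, an excess M bounded both by h h' and by r r', where
   r = d(a,y) + d(b,y) - d(a,b) and h^2 = d(a,b)^2 - (d(a,y) - d(b,y))^2: the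
   first bound is the triangle inequality, the second one Ptolemy's.

   In the pattern 3+3, embed three points x_i of one sign isometrically, for the
   square root of the metric, in a Euclidean plane.  A further point y then sits
   at some height over the plane, and it suffices that for any two points y, y'
   of the other sign the two normal components make an angle of at most 120
   degrees.  Together with a point at infinity the x_i are four isotropic
   vectors of a Lorentzian form of signature (1,3), and y, y' are time-like
   vectors.  Write the midpoint of the normalised y, y' in the basis of the
   isotropic vectors: Ptolemy's inequality allows at most one negative
   coordinate, and averaging the Ptolemy inequalities for y, y' over the pairs
   of isotropic vectors with nonnegative coordinates gives the angle bound.

   The bipartite metric with parts of size 2 and 4, distance 1 across and inside
   the first part, and distance 2 inside the second part shows sharpness. *)

Set Implicit Arguments.
Unset Strict Implicit.
Unset Printing Implicit Defensive.

Import Order.TTheory GRing.Theory Num.Theory.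

Local Open Scope ring_scope.

(** * Scalar inequalities *)

Section ScalarInequalities.
Variable R : rcfType.

Lemma signed_sum_ge (A1 A2 A3 e t1 t2 t3 : R) :
  0 <= e -> 0 <= A1 -> 0 <= A2 -> 0 <= A3 ->
  e <= A1 + A2 - A3 -> e <= A1 - A2 + A3 -> e <= - A1 + A2 + A3 ->
  - A1 <= t1 <= A1 -> - A2 <= t2 <= A2 -> - A3 <= t3 <= A3 ->
  e ^+ 2 <= A1 ^+ 2 + A2 ^+ 2 + A3 ^+ 2 + 2 * (t1 * t2 + t1 * t3 + t2 * t3).
Proof.
move=> e0 a1 a2 a3 h1 h2 h3.
have affine (a b l u t : R) : l <= t <= u -> 0 <= a * l + b -> 0 <= a * u + b ->
    0 <= a * t + b.
  move=> /andP[lt tu] hl hu; case: (lerP 0 a) => a0.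
    by apply: le_trans hl _; rewrite lerD2r ler_wpM2l.
  by apply: le_trans hu _; rewrite lerD2r ler_wnM2l // ltW.
pose F x y z :=
  A1 ^+ 2 + A2 ^+ 2 + A3 ^+ 2 + 2 * (x * y + x * z + y * z) - e ^+ 2.
have sq (s : R) : e <= s -> 0 <= s ^+ 2 - e ^+ 2 by move=> es; nra.
(* F is affine in each variable, so it is enough to look at the vertices. *)
suff /(_ t1 t2 t3) h x y z : - A1 <= x <= A1 -> - A2 <= y <= A2 ->
    - A3 <= z <= A3 -> 0 <= F x y z.
  by move=> t1b t2b t3b; rewrite -subr_ge0; apply: h.
move=> xb yb zb.
have E1 v w u : F u v w = (2 * (v + w)) * u + (F 0 v w) by rewrite /F; ring.
have E2 v w u : F u v w = (2 * (u + w)) * v + (F u 0 w) by rewrite /F; ring.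
have E3 v w u : F u v w = (2 * (u + v)) * w + (F u v 0) by rewrite /F; ring.
rewrite E1; apply: (affine _ _ _ _ _ xb); rewrite -E1 E2; apply: (affine _ _ _ _ _ yb);
  rewrite -E2 E3; apply: (affine _ _ _ _ _ zb); rewrite -E3 /F.
(* At a vertex, [F] is the square of a signed sum of the [A_i] minus [e ^+ 2]; up to a global sign,
   each such sum is at least [e]. *)
- apply: le_trans (sq (A1 + A2 + A3) _) _; [lra|lra].
- apply: le_trans (sq (A1 + A2 - A3) _) _; [lra|lra].
- apply: le_trans (sq (A1 - A2 + A3) _) _; [lra|lra].
- apply: le_trans (sq (- A1 + A2 + A3) _) _; [lra|lra].
- apply: le_trans (sq (- A1 + A2 + A3) _) _; [lra|lra].
- apply: le_trans (sq (A1 - A2 + A3) _) _; [lra|lra].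
- apply: le_trans (sq (A1 + A2 - A3) _) _; [lra|lra].
- apply: le_trans (sq (A1 + A2 + A3) _) _; [lra|lra].
Qed.

Lemma binary_form_ge0 (p q r x y : R) :
  0 <= p -> 0 <= q -> r ^+ 2 <= 4 * p * q ->
  0 <= p * x ^+ 2 + q * y ^+ 2 + r * x * y.
Proof.
rewrite le0r => /orP[/eqP-> | p0] q0 h.
  have -> : r = 0 by apply/eqP; rewrite -sqrf_eq0 eq_le sqr_ge0 andbT; lra.
  by rewrite !mul0r add0r addr0 mulr_ge0 ?sqr_ge0.
rewrite -(pmulr_rge0 _ (_ : 0 < 4 * p)) ?mulr_gt0 //.
have -> : 4 * p * (p * x ^+ 2 + q * y ^+ 2 + r * x * y) =
  (2 * p * x + r * y) ^+ 2 + (4 * p * q - r ^+ 2) * y ^+ 2 by ring.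
by rewrite addr_ge0 ?sqr_ge0 // mulr_ge0 ?sqr_ge0 // subr_ge0.
Qed.

(** By Heron's formula the difference of the two sides is 16 times the squared area of the triangle
    with sides √A, √B, √C. *)
Lemma heron_le (A B C : R) : A <= B + C -> B <= A + C -> C <= A + B ->
  0 <= A -> 0 <= B -> 0 <= C -> (B + C - A) ^+ 2 <= 4 * B * C.
Proof. by move=> *; nra. Qed.

(** Scalar core of the case of one negative coordinate. [signed_sum_ge] is applied to
    [A_i = T * x_i] and [e = T * x0]; given the sum of the [x_i], its three conditions amount to
    [x_i <= K]. *)
Lemma flip_inequality (K n T x0 x1 x2 x3 t1 t2 t3 : R) :
  0 < K -> 0 <= n -> 0 <= T -> K * T ^+ 2 = K - 2 * n ->
  0 <= x0 -> 0 <= x1 <= K -> 0 <= x2 <= K -> 0 <= x3 <= K ->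
  x1 + x2 + x3 = 2 * K + x0 ->
  - (T * x1) <= t1 <= T * x1 -> - (T * x2) <= t2 <= T * x2 ->
  - (T * x3) <= t3 <= T * x3 ->
  (2 * K + x0) ^+ 2 - (t1 + t2 + t3) ^+ 2 -
    (x1 ^+ 2 + x2 ^+ 2 + x3 ^+ 2 - t1 ^+ 2 - t2 ^+ 2 - t3 ^+ 2)
  <= 4 * ((K + x0) * (K - n / 2)).
Proof.
move=> K0 n0 T0 T2 p0 /andP[p1 l1] /andP[p2 l2] /andP[p3 l3] sx b1 b2 b3.
have F : (T * x0) ^+ 2 <= (T * x1) ^+ 2 + (T * x2) ^+ 2 + (T * x3) ^+ 2 +
    2 * (t1 * t2 + t1 * t3 + t2 * t3).
  have tm y z : y <= z -> T * y <= T * z by move=> yz; rewrite ler_wpM2l.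
  apply: signed_sum_ge b1 b2 b3; rewrite ?mulr_ge0 //.
  - by rewrite -!mulrDr -mulrBr tm //; lra.
  - by rewrite -mulrBr -!mulrDr tm //; lra.
  - by rewrite -mulrN -!mulrDr tm //; lra.
have cs : K ^+ 2 + K * x0 + x0 ^+ 2 <= x1 ^+ 2 + x2 ^+ 2 + x3 ^+ 2.
  have h : (2 * K + x0) ^+ 2 <= 3 * (x1 ^+ 2 + x2 ^+ 2 + x3 ^+ 2).
    rewrite -sx; have := sqr_ge0 (x1 - x2); have := sqr_ge0 (x1 - x3).
    have := sqr_ge0 (x2 - x3); lra.
  (* Three summands at most [K] force [x0 <= K]. The product is the difference of
     [(2 * K + x0) ^+ 2] and three times the left side of [cs]. *)
  have : 0 <= (K - x0) * (K + 2 * x0) by apply: mulr_ge0; lra.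
  lra.
have {}cs := ler_wpM2l n0 cs.
have {}F := ler_wpM2l (ltW K0) F.
have {}F : (K - 2 * n) * x0 ^+ 2 <= (K - 2 * n) * (x1 ^+ 2 + x2 ^+ 2 + x3 ^+ 2)
    + K * (2 * (t1 * t2 + t1 * t3 + t2 * t3)) by move: F; rewrite -T2; lra.
by rewrite -(ler_pM2l K0); lra.
Qed.

End ScalarInequalities.

(** * Five points *)

(* D is a Lorentzian Gram matrix up to sign.  For time-like vectors y, y' with
   the same norm n and product K - n, m and d are the coordinates of y + y' and
   y' - y along isotropic vectors, and b plays the part of D y y'. *)
Section Tetrahedron.
Variables (R : rcfType) (I : Type) (D : I -> I -> R).
Hypothesis Dsym : forall i k, D i k = D k i.
Variables (m d : I -> R) (b K n : R).
Hypothesis hb : forall i k, 2 * (D i k * b) <= m i * m k - d i * d k.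
Hypothesis ht : forall i j k, D i k * m j <= D i j * m k + D k j * m i.
Hypothesis m_ge0 : forall i, 0 <= m i.
Hypothesis K_gt0 : 0 < K.
Hypothesis n_ge0 : 0 <= n.

(** Average [hb] over the six pairs with weights [c_i c_k]; the sum of [c_i c_k D i k] is [K]. On
    the right only squares remain, and the [q_i] together with Cauchy-Schwarz for the four numbers
    [c_i m_i] of sum [2 * K] bound them. *)
Lemma tetra_bound_convex (i0 i1 i2 i3 : I) (c0 c1 c2 c3 : R) :
  m i0 = c1 * D i0 i1 + c2 * D i0 i2 + c3 * D i0 i3 ->
  m i1 = c0 * D i1 i0 + c2 * D i1 i2 + c3 * D i1 i3 ->
  m i2 = c0 * D i2 i0 + c1 * D i2 i1 + c3 * D i2 i3 ->
  m i3 = c0 * D i3 i0 + c1 * D i3 i1 + c2 * D i3 i2 ->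
  c0 * m i0 + c1 * m i1 + c2 * m i2 + c3 * m i3 = 2 * K ->
  c0 * d i0 + c1 * d i1 + c2 * d i2 + c3 * d i3 = 0 ->
  K * d i0 ^+ 2 <= (K - 2 * n) * m i0 ^+ 2 ->
  K * d i1 ^+ 2 <= (K - 2 * n) * m i1 ^+ 2 ->
  K * d i2 ^+ 2 <= (K - 2 * n) * m i2 ^+ 2 ->
  K * d i3 ^+ 2 <= (K - 2 * n) * m i3 ^+ 2 ->
  0 <= c0 -> 0 <= c1 -> 0 <= c2 -> 0 <= c3 ->
  b <= K - n / 2.
Proof.
move=> r0 r1 r2 r3 sm sd q0 q1 q2 q3 p0 p1 p2 p3.
have pair i k x y : 0 <= x -> 0 <= y ->
    2 * (x * y * D i k) * b <= (x * m i) * (y * m k) - (x * d i) * (y * d k).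
  move=> x0 y0; have := ler_wpM2l (mulr_ge0 x0 y0) (hb i k); lra.
have pt i x : K * d i ^+ 2 <= (K - 2 * n) * m i ^+ 2 ->
    2 * n * (x * m i) ^+ 2 <= K * ((x * m i) ^+ 2 - (x * d i) ^+ 2).
  by move=> q; have := ler_wpM2l (sqr_ge0 x) q; lra.
have {pair} s : 2 * K * b <= (2 * K) ^+ 2 / 2 -
    ((c0 * m i0) ^+ 2 - (c0 * d i0) ^+ 2 + ((c1 * m i1) ^+ 2 - (c1 * d i1) ^+ 2)
    + ((c2 * m i2) ^+ 2 - (c2 * d i2) ^+ 2)
    + ((c3 * m i3) ^+ 2 - (c3 * d i3) ^+ 2)) / 2.
  have -> : 2 * K * b = 2 * (c0 * c1 * D i0 i1) * b + 2 * (c0 * c2 * D i0 i2) * b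
     + 2 * (c0 * c3 * D i0 i3) * b + 2 * (c1 * c2 * D i1 i2) * b
     + 2 * (c1 * c3 * D i1 i3) * b + 2 * (c2 * c3 * D i2 i3) * b.
    rewrite -sm r0 r1 r2 r3 !(Dsym i1 i0, Dsym i2 i0, Dsym i3 i0, Dsym i2 i1,
      Dsym i3 i1, Dsym i3 i2); ring.
  have -> : (2 * K) ^+ 2 =
    (2 * K) ^+ 2 - (c0 * d i0 + c1 * d i1 + c2 * d i2 + c3 * d i3) ^+ 2.
    by rewrite sd; ring.
  rewrite -sm.
  have := pair i0 i1 _ _ p0 p1; have := pair i0 i2 _ _ p0 p2.
  have := pair i0 i3 _ _ p0 p3; have := pair i1 i2 _ _ p1 p2.
  have := pair i1 i3 _ _ p1 p3; have := pair i2 i3 _ _ p2 p3.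
  lra.
have {}q0 := pt _ c0 q0; have {}q1 := pt _ c1 q1.
have {}q2 := pt _ c2 q2; have {pt q3} := pt _ c3 q3.
move: sm s q0 q1 q2.
set x0 := c0 * m i0; set x1 := c1 * m i1; set x2 := c2 * m i2.
set x3 := c3 * m i3.
move: (c0 * d i0) (c1 * d i1) (c2 * d i2) (c3 * d i3) => e0 e1 e2 e3.
move: x0 x1 x2 x3 => x0 x1 x2 x3 sm s q0 q1 q2 q3.
have CS : K ^+ 2 <= x0 ^+ 2 + x1 ^+ 2 + x2 ^+ 2 + x3 ^+ 2.
  have -> : K = (x0 + x1 + x2 + x3) / 2 by rewrite sm; field.
  have := sqr_ge0 (x0 - x1); have := sqr_ge0 (x0 - x2).
  have := sqr_ge0 (x0 - x3); have := sqr_ge0 (x1 - x2).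
  have := sqr_ge0 (x1 - x3); have := sqr_ge0 (x2 - x3); lra.
have {}CS := ler_wpM2l n_ge0 CS.
rewrite -(ler_pM2l K_gt0) -(ler_pM2l K_gt0).
have := ler_wpM2l (ltW K_gt0) s; lra.
Qed.

(** The pairs containing [i0] contribute [c0 * m i0 = - x0] to the total [K] of the [c_i c_k D i k],
    so the three other pairs have total weight [K + x0]. Averaging over these reduces the claim to
    [flip_inequality]. *)
Lemma tetra_bound_flip (i0 i1 i2 i3 : I) (c0 c1 c2 c3 : R) :
  0 < D i0 i1 -> 0 < D i0 i2 -> 0 < D i0 i3 ->
  m i0 = c1 * D i0 i1 + c2 * D i0 i2 + c3 * D i0 i3 ->
  m i1 = c0 * D i1 i0 + c2 * D i1 i2 + c3 * D i1 i3 ->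
  m i2 = c0 * D i2 i0 + c1 * D i2 i1 + c3 * D i2 i3 ->
  m i3 = c0 * D i3 i0 + c1 * D i3 i1 + c2 * D i3 i2 ->
  c0 * m i0 + c1 * m i1 + c2 * m i2 + c3 * m i3 = 2 * K ->
  c0 * d i0 + c1 * d i1 + c2 * d i2 + c3 * d i3 = 0 ->
  K * d i0 ^+ 2 <= (K - 2 * n) * m i0 ^+ 2 ->
  K * d i1 ^+ 2 <= (K - 2 * n) * m i1 ^+ 2 ->
  K * d i2 ^+ 2 <= (K - 2 * n) * m i2 ^+ 2 ->
  K * d i3 ^+ 2 <= (K - 2 * n) * m i3 ^+ 2 ->
  2 * n <= K ->
  c0 <= 0 -> 0 <= c1 -> 0 <= c2 -> 0 <= c3 ->
  b <= K - n / 2.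
Proof.
move=> D1 D2 D3 r0 r1 r2 r3 sm sd q0 q1 q2 q3 nK p0 p1 p2 p3.
have pair i k x y : 0 <= x -> 0 <= y ->
    2 * (x * y * D i k) * b <= (x * m i) * (y * m k) - (x * d i) * (y * d k).
  move=> x0 y0; have := ler_wpM2l (mulr_ge0 x0 y0) (hb i k); lra.
(* Substituting the rows of [x] and [i0] writes [D i0 x * (2 * K - 2 * e1 * m x)] as [e2] and [e3]
   times the slacks of [ht] for [x, i0, y] and [x, i0, z]. *)
have le_K x y z e1 e2 e3 : 0 < D i0 x -> 0 <= e2 -> 0 <= e3 ->
   m x = c0 * D x i0 + e2 * D x y + e3 * D x z ->
   m i0 = e1 * D i0 x + e2 * D i0 y + e3 * D i0 z ->
   c0 * m i0 + e1 * m x + e2 * m y + e3 * m z = 2 * K -> e1 * m x <= K.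
  move=> Dx e2p e3p rx ry sK.
  have h2 := ler_wpM2l e2p (ht x i0 y); have h3 := ler_wpM2l e3p (ht x i0 z).
  rewrite -(ler_pM2l Dx).
  have := congr1 ( *%R^~ (m i0)) rx; have := congr1 ( *%R^~ (m x)) ry.
  have := congr1 ( *%R^~ (D i0 x)) sK => /=.
  move: h2 h3; rewrite !(Dsym y i0, Dsym z i0, Dsym x i0); lra.
have k1 : c1 * m i1 <= K by apply: (le_K i1 i2 i3 c1 c2 c3).
have k2 : c2 * m i2 <= K by apply: (le_K i2 i1 i3 c2 c1 c3) => //; lra.
have k3 : c3 * m i3 <= K by apply: (le_K i3 i1 i2 c3 c1 c2) => //; lra.
have bnd i x : 0 <= x -> K * d i ^+ 2 <= (K - 2 * n) * m i ^+ 2 ->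
   - (Num.sqrt ((K - 2 * n) / K) * (x * m i)) <= x * d i
     <= Num.sqrt ((K - 2 * n) / K) * (x * m i).
  move=> x0 q; rewrite -ler_norml normrM ger0_norm // mulrCA ler_wpM2l //.
  rewrite -sqrtr_sqr -[m i](ger0_norm (m_ge0 i)) -sqrtr_sqr -sqrtrM.
    by rewrite ler_wsqrtr // mulrAC ler_pdivlMr // mulrC.
  by rewrite divr_ge0 ?subr_ge0 // ltW.
(* Only the pairs inside {i1, i2, i3} are averaged; x0 measures how far the
   point lies beyond the face opposite to i0. *)
pose x0 := - c0 * m i0; pose x1 := c1 * m i1; pose x2 := c2 * m i2.
pose x3 := c3 * m i3; pose t0 := - c0 * d i0.
have pc0 : 0 <= - c0 by rewrite oppr_ge0.
have x0_ge0 : 0 <= x0 by rewrite mulr_ge0.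
have x1_ge0 : 0 <= x1 by rewrite mulr_ge0.
have x2_ge0 : 0 <= x2 by rewrite mulr_ge0.
have x3_ge0 : 0 <= x3 by rewrite mulr_ge0.
have sx : x1 + x2 + x3 = 2 * K + x0 by rewrite -sm /x0 /x1 /x2 /x3; ring.
have st : c1 * d i1 + c2 * d i2 + c3 * d i3 = t0.
  by rewrite /t0 -[LHS]subr0 -sd; ring.
have s : 2 * (K + x0) * b <= ((2 * K + x0) ^+ 2 - t0 ^+ 2 - (x1 ^+ 2 + x2 ^+ 2
    + x3 ^+ 2 - (c1 * d i1) ^+ 2 - (c2 * d i2) ^+ 2 - (c3 * d i3) ^+ 2)) / 2.
  have -> : 2 * (K + x0) * b = 2 * (c1 * c2 * D i1 i2) * b
     + 2 * (c1 * c3 * D i1 i3) * b + 2 * (c2 * c3 * D i2 i3) * b.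
    rewrite /x0 mulrDr -sm r0 r1 r2 r3 !(Dsym i1 i0, Dsym i2 i0, Dsym i3 i0,
      Dsym i2 i1, Dsym i3 i1, Dsym i3 i2); ring.
  rewrite -sx -st /x1 /x2 /x3.
  have := pair i1 i2 _ _ p1 p2; have := pair i1 i3 _ _ p1 p3.
  have := pair i2 i3 _ _ p2 p3; lra.
have T2 : K * Num.sqrt ((K - 2 * n) / K) ^+ 2 = K - 2 * n.
  by rewrite sqr_sqrtr ?divr_ge0 ?subr_ge0 // ?ltW // mulrC divfK // gt_eqF.
have xx x : 0 <= x -> x <= K -> 0 <= x <= K by move=> -> ->.
have := flip_inequality K_gt0 n_ge0 (sqrtr_ge0 _) T2 x0_ge0 (xx _ x1_ge0 k1)
  (xx _ x2_ge0 k2) (xx _ x3_ge0 k3) sx (bnd _ _ p1 q1) (bnd _ _ p2 q2)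
  (bnd _ _ p3 q3).
rewrite st => F.
by rewrite -(ler_pM2l (_ : 0 < K + x0)) ?ltr_pwDl //; lra.
Qed.

Hypothesis Dptol :
  forall i j k l, D i j * D k l <= D i k * D j l + D i l * D j k.

Local Ltac by_rows r0 r1 r2 r3 sm sd :=
  first [ exact: ltW | by rewrite [LHS]r0; ring | by rewrite [LHS]r1; ring
        | by rewrite [LHS]r2; ring | by rewrite [LHS]r3; ring
        | by rewrite -[RHS]sm; ring | by rewrite -[RHS]sd; ring ].

(** At most one coordinate is negative, so up to relabelling one of the two preceding bounds
    applies. *)
Lemma tetra_bound (i0 i1 i2 i3 : I) (c0 c1 c2 c3 : R) :
  0 < D i0 i1 -> 0 < D i0 i2 -> 0 < D i0 i3 ->
  0 < D i1 i2 -> 0 < D i1 i3 -> 0 < D i2 i3 ->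
  m i0 = c1 * D i0 i1 + c2 * D i0 i2 + c3 * D i0 i3 ->
  m i1 = c0 * D i1 i0 + c2 * D i1 i2 + c3 * D i1 i3 ->
  m i2 = c0 * D i2 i0 + c1 * D i2 i1 + c3 * D i2 i3 ->
  m i3 = c0 * D i3 i0 + c1 * D i3 i1 + c2 * D i3 i2 ->
  c0 * m i0 + c1 * m i1 + c2 * m i2 + c3 * m i3 = 2 * K ->
  c0 * d i0 + c1 * d i1 + c2 * d i2 + c3 * d i3 = 0 ->
  K * d i0 ^+ 2 <= (K - 2 * n) * m i0 ^+ 2 ->
  K * d i1 ^+ 2 <= (K - 2 * n) * m i1 ^+ 2 ->
  K * d i2 ^+ 2 <= (K - 2 * n) * m i2 ^+ 2 ->
  K * d i3 ^+ 2 <= (K - 2 * n) * m i3 ^+ 2 ->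
  2 * n <= K ->
  b <= K - n / 2.
Proof.
move=> D01 D02 D03 D12 D13 D23 r0 r1 r2 r3 sm sd q0 q1 q2 q3 nK.
(* After inserting the rows, the slack of [ht p r q] is [2 * cr * D p r * D q r] plus [cs] times the
   slack of Ptolemy's inequality for [p, q, r, s]. *)
have one_neg p q r s cp cq cr cs : 0 < D p r -> 0 < D q r ->
    m p = cq * D p q + cr * D p r + cs * D p s ->
    m q = cp * D q p + cr * D q r + cs * D q s ->
    m r = cp * D r p + cq * D r q + cs * D r s -> cs <= 0 -> 0 <= cr.
  move=> pr qr mp mq mr cs0; rewrite -(pmulr_rge0 _ (mulr_gt0 pr qr)).
  have := ht p r q; rewrite mp mq mr.
  have := Dptol p q r s; rewrite -subr_ge0 => /(mulr_le0_ge0 cs0).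
  rewrite !(Dsym q p, Dsym r p, Dsym r q); lra.
have S10 : 0 < D i1 i0 by rewrite Dsym.
have S20 : 0 < D i2 i0 by rewrite Dsym.
have S30 : 0 < D i3 i0 by rewrite Dsym.
have S21 : 0 < D i2 i1 by rewrite Dsym.
have S31 : 0 < D i3 i1 by rewrite Dsym.
have S32 : 0 < D i3 i2 by rewrite Dsym.
have flip := tetra_bound_flip.
case: (lerP 0 c0) => p0; last first.
  have p1 : 0 <= c1 by apply: (one_neg i2 i3 i1 i0 c2 c3 c1 c0) => //;
    by_rows r0 r1 r2 r3 sm sd.
  have p2 : 0 <= c2 by apply: (one_neg i1 i3 i2 i0 c1 c3 c2 c0) => //;
    by_rows r0 r1 r2 r3 sm sd.
  have p3 : 0 <= c3 by apply: (one_neg i1 i2 i3 i0 c1 c2 c3 c0) => //;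
    by_rows r0 r1 r2 r3 sm sd.
  by apply: (flip i0 i1 i2 i3 c0 c1 c2 c3) => //;
    by_rows r0 r1 r2 r3 sm sd.
case: (lerP 0 c1) => p1; last first.
  have p2 : 0 <= c2 by apply: (one_neg i0 i3 i2 i1 c0 c3 c2 c1) => //;
    by_rows r0 r1 r2 r3 sm sd.
  have p3 : 0 <= c3 by apply: (one_neg i0 i2 i3 i1 c0 c2 c3 c1) => //;
    by_rows r0 r1 r2 r3 sm sd.
  by apply: (flip i1 i0 i2 i3 c1 c0 c2 c3) => //;
    by_rows r0 r1 r2 r3 sm sd.
case: (lerP 0 c2) => p2; last first.
  have p3 : 0 <= c3 by apply: (one_neg i0 i1 i3 i2 c0 c1 c3 c2) => //;
    by_rows r0 r1 r2 r3 sm sd.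
  by apply: (flip i2 i0 i1 i3 c2 c0 c1 c3) => //;
    by_rows r0 r1 r2 r3 sm sd.
case: (lerP 0 c3) => p3; last first.
  by apply: (flip i3 i0 i1 i2 c3 c0 c1 c2) => //;
    by_rows r0 r1 r2 r3 sm sd.
exact: (tetra_bound_convex r0 r1 r2 r3 sm sd q0 q1 q2 q3).
Qed.
End Tetrahedron.

(** * Two points over four isotropic vectors: the bound of 120 degrees *)

Section FivePoints.
Variables (R : rcfType) (I : Type) (D : I -> I -> R).
Hypothesis D_ge0 : forall i k, 0 <= D i k.
Hypothesis Dsym : forall i k, D i k = D k i.
Hypothesis Dptol :
  forall i j k l, D i j * D k l <= D i k * D j l + D i l * D j k.

(** In a Lorentzian space the form is semidefinite on the orthogonal complement of an isotropic
    vector, here that of [i0]. Eliminating [e1] leaves a binary form in [e2, e3]; its discriminant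
    has the right sign by [heron_le], because Ptolemy's inequality makes the three products of
    opposite distances satisfy the triangle inequalities. *)
Lemma isotropic_orthogonal (i0 i1 i2 i3 : I) (e0 e1 e2 e3 : R) :
  0 < D i0 i1 -> e1 * D i0 i1 + e2 * D i0 i2 + e3 * D i0 i3 = 0 ->
  e0 * e1 * D i0 i1 + e0 * e2 * D i0 i2 + e0 * e3 * D i0 i3
  + e1 * e2 * D i1 i2 + e1 * e3 * D i1 i3 + e2 * e3 * D i2 i3 <= 0.
Proof.
move=> D01 e0E.
have F : 0 <= (D i0 i2 * D i1 i2) * e2 ^+ 2 + (D i0 i3 * D i1 i3) * e3 ^+ 2
    + (D i0 i2 * D i1 i3 + D i0 i3 * D i1 i2 - D i0 i1 * D i2 i3) * e2 * e3.
  apply: binary_form_ge0; rewrite ?mulr_ge0 //.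
  have -> : 4 * (D i0 i2 * D i1 i2) * (D i0 i3 * D i1 i3) =
            4 * (D i0 i2 * D i1 i3) * (D i0 i3 * D i1 i2) by ring.
  apply: heron_le; rewrite ?mulr_ge0 //; have := Dptol i0 i1 i2 i3;
    have := Dptol i0 i2 i1 i3; have := Dptol i0 i3 i1 i2;
    rewrite !(Dsym i2 i1, Dsym i3 i1, Dsym i3 i2); lra.
rewrite -(ler_pM2l D01) mulr0 -oppr_ge0; apply: le_trans F _.
rewrite le_eqVlt; apply/orP; left; apply/eqP.
have E1 : e1 * D i0 i1 = - (e2 * D i0 i2 + e3 * D i0 i3) by lra.
transitivity (- (D i0 i1 * e0 * (e1 * D i0 i1 + e2 * D i0 i2 + e3 * D i0 i3)
  + (e1 * D i0 i1) * (e2 * D i1 i2 + e3 * D i1 i3) + D i0 i1 * (e2 * e3 * D i2 i3))).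
  by rewrite e0E E1; ring.
by ring.
Qed.

Variables (i0 i1 i2 i3 : I).
Hypothesis D01 : 0 < D i0 i1.
Hypothesis D02 : 0 < D i0 i2.
Hypothesis D03 : 0 < D i0 i3.
Hypothesis D12 : 0 < D i1 i2.
Hypothesis D13 : 0 < D i1 i3.
Hypothesis D23 : 0 < D i2 i3.

(** [N], [N'] and [N12] are the norms and the product of the vectors with coordinates [a] and [b].
    When [i0] is the point at infinity, [N] is twice the squared height of [y], and the bound says
    that the two normal components make an angle of at most 120 degrees. *)
Lemma five_point_bound (y y' : I) (a0 a1 a2 a3 b0 b1 b2 b3 N N' N12 : R) :
  D i0 y = a1 * D i0 i1 + a2 * D i0 i2 + a3 * D i0 i3 ->
  D i1 y = a0 * D i1 i0 + a2 * D i1 i2 + a3 * D i1 i3 ->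
  D i2 y = a0 * D i2 i0 + a1 * D i2 i1 + a3 * D i2 i3 ->
  D i3 y = a0 * D i3 i0 + a1 * D i3 i1 + a2 * D i3 i2 ->
  D i0 y' = b1 * D i0 i1 + b2 * D i0 i2 + b3 * D i0 i3 ->
  D i1 y' = b0 * D i1 i0 + b2 * D i1 i2 + b3 * D i1 i3 ->
  D i2 y' = b0 * D i2 i0 + b1 * D i2 i1 + b3 * D i2 i3 ->
  D i3 y' = b0 * D i3 i0 + b1 * D i3 i1 + b2 * D i3 i2 ->
  N = a0 * D i0 y + a1 * D i1 y + a2 * D i2 y + a3 * D i3 y ->
  N' = b0 * D i0 y' + b1 * D i1 y' + b2 * D i2 y' + b3 * D i3 y' ->
  N12 = a0 * D i0 y' + a1 * D i1 y' + a2 * D i2 y' + a3 * D i3 y' ->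
  0 < N -> 0 < N' -> 0 < D i0 y -> 0 < D i0 y' ->
  D y y' <= N12 + Num.sqrt N * Num.sqrt N' / 2.
Proof.
move=> ra0 ra1 ra2 ra3 rb0 rb1 rb2 rb3 NE N'E N12E N0 N'0 y0 y'0.
have N12E' : N12 = b0 * D i0 y + b1 * D i1 y + b2 * D i2 y + b3 * D i3 y.
  rewrite N12E ra0 ra1 ra2 ra3 rb0 rb1 rb2 rb3.
  rewrite !(Dsym i1 i0, Dsym i2 i0, Dsym i3 i0, Dsym i2 i1, Dsym i3 i1,
    Dsym i3 i2); ring.
pose f := Num.sqrt N; pose f' := Num.sqrt N'.
have f0 : 0 < f by rewrite sqrtr_gt0.
have f'0 : 0 < f' by rewrite sqrtr_gt0.
have f2 : f ^+ 2 = N by rewrite sqr_sqrtr ?ltW.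
have f'2 : f' ^+ 2 = N' by rewrite sqr_sqrtr ?ltW.
(* Scaling [y] by [f'] and [y'] by [f] gives both the norm [N * N']; their product becomes
   [f * f' * N12]. *)
pose m i := f' * D i y + f * D i y'; pose d i := f * D i y' - f' * D i y.
pose K := N * N' + f * f' * N12.
have m_ge0 i : 0 <= m i by rewrite addr_ge0 // mulr_ge0 // ltW.
(* The right side equals [2 * f * f'] times [D i y * D k y' + D i y' * D k y]. *)
have hb i k : 2 * (D i k * (f * f' * D y y')) <= m i * m k - d i * d k.
  have := ler_wpM2l (ltW (mulr_gt0 f0 f'0)) (Dptol i k y y').
  by rewrite /m /d; lra.
have ht i j k : D i k * m j <= D i j * m k + D k j * m i.
  rewrite /m; have := ler_wpM2l (ltW f0) (Dptol i k j y').
  have := ler_wpM2l (ltW f'0) (Dptol i k j y); rewrite !(Dsym k j); lra.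
have cross p q : 2 * ((q * a0 - p * b0) * (q * a1 - p * b1) * D i0 i1
    + (q * a0 - p * b0) * (q * a2 - p * b2) * D i0 i2
    + (q * a0 - p * b0) * (q * a3 - p * b3) * D i0 i3
    + (q * a1 - p * b1) * (q * a2 - p * b2) * D i1 i2
    + (q * a1 - p * b1) * (q * a3 - p * b3) * D i1 i3
    + (q * a2 - p * b2) * (q * a3 - p * b3) * D i2 i3)
    = q ^+ 2 * N - 2 * (p * q * N12) + p ^+ 2 * N'.
  have -> : 2 * (p * q * N12) = p * q * N12 + p * q * N12 by ring.
  rewrite NE N'E {1}N12E N12E' ra0 ra1 ra2 ra3 rb0 rb1 rb2 rb3.
  rewrite !(Dsym i1 i0, Dsym i2 i0, Dsym i3 i0, Dsym i2 i1, Dsym i3 i1,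
    Dsym i3 i2); ring.
have lorentz i p q : p = D i y -> q = D i y' ->
    q ^+ 2 * N - 2 * (p * q * N12) + p ^+ 2 * N' <= 0 ->
    K * d i ^+ 2 <= (K - 2 * (N * N')) * m i ^+ 2.
  move=> pE qE h; rewrite /K /m /d -pE -qE -f2 -f'2.
  have := ler_wpM2l (ltW (mulr_gt0 N0 N'0)) h; rewrite -f2 -f'2; lra.
have l0 : D i0 y' ^+ 2 * N - 2 * (D i0 y * D i0 y' * N12) + D i0 y ^+ 2 * N' <= 0.
  rewrite -cross pmulr_rle0 //.
  by apply: isotropic_orthogonal => //; rewrite ra0 rb0; ring.
have q0 := lorentz i0 _ _ erefl erefl l0.
have q1 : K * d i1 ^+ 2 <= (K - 2 * (N * N')) * m i1 ^+ 2.
  apply: (lorentz i1 _ _ erefl erefl); rewrite -cross pmulr_rle0 //.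
  have := @isotropic_orthogonal i1 i0 i2 i3
    (D i1 y' * a1 - D i1 y * b1) (D i1 y' * a0 - D i1 y * b0)
    (D i1 y' * a2 - D i1 y * b2) (D i1 y' * a3 - D i1 y * b3).
  rewrite !(Dsym i1 i0) => /(_ D01) F; apply: le_trans (F _); first by lra.
  by rewrite ra1 rb1 !(Dsym i1 i0); ring.
have q2 : K * d i2 ^+ 2 <= (K - 2 * (N * N')) * m i2 ^+ 2.
  apply: (lorentz i2 _ _ erefl erefl); rewrite -cross pmulr_rle0 //.
  have := @isotropic_orthogonal i2 i0 i1 i3
    (D i2 y' * a2 - D i2 y * b2) (D i2 y' * a0 - D i2 y * b0)
    (D i2 y' * a1 - D i2 y * b1) (D i2 y' * a3 - D i2 y * b3).
  rewrite !(Dsym i2 i0, Dsym i2 i1) => /(_ D02) F.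
  apply: le_trans (F _); first by lra.
  by rewrite ra2 rb2 !(Dsym i2 i0, Dsym i2 i1); ring.
have q3 : K * d i3 ^+ 2 <= (K - 2 * (N * N')) * m i3 ^+ 2.
  apply: (lorentz i3 _ _ erefl erefl); rewrite -cross pmulr_rle0 //.
  have := @isotropic_orthogonal i3 i0 i1 i2
    (D i3 y' * a3 - D i3 y * b3) (D i3 y' * a0 - D i3 y * b0)
    (D i3 y' * a1 - D i3 y * b1) (D i3 y' * a2 - D i3 y * b2).
  rewrite !(Dsym i3 i0, Dsym i3 i1, Dsym i3 i2) => /(_ D03) F.
  apply: le_trans (F _); first by lra.
  by rewrite ra3 rb3 !(Dsym i3 i0, Dsym i3 i1, Dsym i3 i2); ring.
(* The reversed Cauchy-Schwarz inequality for time-like vectors, from [l0] and AM-GM. *)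
have ff'_le : f * f' <= N12.
  rewrite -(ler_pM2l (_ : 0 < 2 * (D i0 y * D i0 y'))); last first.
    by rewrite !mulr_gt0.
  move: l0; rewrite -f2 -f'2; have := sqr_ge0 (f * D i0 y' - f' * D i0 y); lra.
have n0 : 0 <= N * N' by rewrite mulr_ge0 ?ltW.
have nK : 2 * (N * N') <= K.
  have := ler_wpM2l (ltW (mulr_gt0 f0 f'0)) ff'_le; rewrite /K -f2 -f'2; lra.
have K0 : 0 < K by apply: lt_le_trans nK; rewrite !mulr_gt0.
pose c0 := f' * a0 + f * b0; pose c1 := f' * a1 + f * b1.
pose c2 := f' * a2 + f * b2; pose c3 := f' * a3 + f * b3.
have r0 : m i0 = c1 * D i0 i1 + c2 * D i0 i2 + c3 * D i0 i3.
  by rewrite /m ra0 rb0 /c1 /c2 /c3; ring.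
have r1 : m i1 = c0 * D i1 i0 + c2 * D i1 i2 + c3 * D i1 i3.
  by rewrite /m ra1 rb1 /c0 /c2 /c3; ring.
have r2 : m i2 = c0 * D i2 i0 + c1 * D i2 i1 + c3 * D i2 i3.
  by rewrite /m ra2 rb2 /c0 /c1 /c3; ring.
have r3 : m i3 = c0 * D i3 i0 + c1 * D i3 i1 + c2 * D i3 i2.
  by rewrite /m ra3 rb3 /c0 /c1 /c2; ring.
have sm : c0 * m i0 + c1 * m i1 + c2 * m i2 + c3 * m i3 = 2 * K.
  transitivity (f' ^+ 2 * N + f ^+ 2 * N' + f * f' * N12 + f * f' * N12).
    by rewrite {1}N12E N12E' NE N'E /c0 /c1 /c2 /c3 /m; ring.
  by rewrite /K f2 f'2; ring.
have sd : c0 * d i0 + c1 * d i1 + c2 * d i2 + c3 * d i3 = 0.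
  transitivity (f ^+ 2 * N' - f' ^+ 2 * N + f * f' * N12 - f * f' * N12).
    by rewrite {1}N12E N12E' NE N'E /c0 /c1 /c2 /c3 /d; ring.
  by rewrite f2 f'2; ring.
have ff'0 := mulr_gt0 f0 f'0.
suff : f * f' * D y y' <= K - N * N' / 2.
  rewrite -/f -/f' -[D y y' <= _](ler_pM2l ff'0) /K.
  by rewrite -f2 -f'2; lra.
exact: (tetra_bound Dsym hb ht m_ge0 K0 n0 Dptol D01 D02 D03 D12 D13 D23
  r0 r1 r2 r3 sm sd q0 q1 q2 q3 nK).
Qed.
End FivePoints.

(** * Two points against four *)

Section FourWeights.
Variable R : rcfType.

Lemma weighted_amgm (u v M w w' : R) :
  0 <= u -> 0 <= v -> 0 <= w -> 0 <= w' -> (0 <= M -> M ^+ 2 <= u * v) ->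
  2 * (w * w' * M) <= w ^+ 2 * u + w' ^+ 2 * v.
Proof.
move=> u0 v0 w0 w'0 h; case: (lerP 0 M) => M0; last first.
  apply: (@le_trans _ _ 0); last by rewrite addr_ge0 // mulr_ge0 ?sqr_ge0.
  by rewrite pmulr_rle0 // mulr_ge0_le0 ?mulr_ge0 // ltW.
have := @binary_form_ge0 _ u v (- 2 * M) w w' u0 v0.
have -> : (- 2 * M) ^+ 2 = 4 * M ^+ 2 by ring.
by rewrite -mulrA ler_pM2l // => /(_ (h M0)); lra.
Qed.

(** For the pair of the only index with [h <= r] and another one: the first index splits its budget
    [2 * c * r + h ^+ 2] evenly over its three pairs, and the second has already spent [r' ^+ 2] on
    each of its two other pairs. *)
Lemma lone_large_sqr_le (c h r h' r' M : R) :
  h <= c -> h' <= c -> 0 <= h -> 0 <= h' -> 0 <= r -> 0 <= r' ->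
  h <= r -> r' <= h' -> 0 <= M -> M <= h * h' -> M <= r * r' ->
  M ^+ 2 <= ((2 * c * r + h ^+ 2) / 3) *
            (2 * c * r' + h' ^+ 2 - 2 * r' ^+ 2).
Proof.
move=> hc h'c h0 h'0 r0 r'0 hr rh' M0 Mh Mr.
(* The second factor with [c] lowered to [h']; in the first factor [c] is lowered to [h]. *)
pose g := h' ^+ 2 + 2 * h' * r' - 2 * r' ^+ 2.
have gh : h' ^+ 2 <= g.
  by have := mulr_ge0 r'0 (_ : 0 <= h' - r'); rewrite subr_ge0 /g; lra.
have g0 : 0 <= g by apply: le_trans gh; rewrite sqr_ge0.
apply: (@le_trans _ _ (((2 * h * r + h ^+ 2) / 3) * g)); last first.
  apply: ler_pM => //; first by rewrite divr_ge0 ?addr_ge0 ?mulr_ge0.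
    by rewrite ler_pM2r ?invr_gt0 // lerD2r -!mulrA ler_pM2l // ler_wpM2r.
  by rewrite /g lerD2r addrC lerD2r -!mulrA ler_pM2l // ler_wpM2r.
have sq x : 0 <= x -> M <= x -> M ^+ 2 <= x ^+ 2.
  by move=> x0 Mx; rewrite ler_pXn2r.
case: (lerP (h * h') (r * r')) => cmp.
  apply: le_trans (sq _ (mulr_ge0 h0 h'0) Mh) _.
  have {}gh := ler_wpM2l (sqr_ge0 h) gh.
  have : 0 <= h * (r - h) * g by rewrite !mulr_ge0 // subr_ge0.
  lra.
have h_gt0 : 0 < h.
  rewrite lt_def h0 andbT; apply/eqP => hE.
  by move: cmp; rewrite hE mul0r ltNge mulr_ge0.
apply: le_trans (sq _ (mulr_ge0 r0 r'0) Mr) _.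
have G : r' ^+ 2 * (r ^+ 2 + 2 * r * h - 2 * h ^+ 2) <= h ^+ 2 * g.
  have e1 : r * r' <= h * h' by apply: ltW.
  have e2 : (r * r') ^+ 2 <= (h * h') ^+ 2 by rewrite ler_pXn2r // nnegrE mulr_ge0.
  have e3 := ler_wpM2l (mulr_ge0 h0 r'0) e1.
  by rewrite /g; lra.
rewrite -(ler_pM2l h_gt0).
have p : 0 <= 2 * r + h by rewrite addr_ge0 // mulr_ge0.
have := ler_wpM2l p G.
have : 0 <= r' ^+ 2 * ((r + h) ^+ 2 * (r - h)).
  by rewrite mulr_ge0 ?sqr_ge0 // mulr_ge0 ?sqr_ge0 // subr_ge0.
lra.
Qed.

Lemma four_weights_bound (c h1 h2 h3 h4 r1 r2 r3 r4 w1 w2 w3 w4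
    M12 M13 M14 M23 M24 M34 : R) :
  0 <= h1 <= c -> 0 <= h2 <= c -> 0 <= h3 <= c -> 0 <= h4 <= c ->
  0 <= r1 -> 0 <= r2 -> 0 <= r3 -> 0 <= r4 ->
  0 <= w1 -> 0 <= w2 -> 0 <= w3 -> 0 <= w4 ->
  M12 <= h1 * h2 -> M12 <= r1 * r2 -> M13 <= h1 * h3 -> M13 <= r1 * r3 ->
  M14 <= h1 * h4 -> M14 <= r1 * r4 -> M23 <= h2 * h3 -> M23 <= r2 * r3 ->
  M24 <= h2 * h4 -> M24 <= r2 * r4 -> M34 <= h3 * h4 -> M34 <= r3 * r4 ->
  2 * (w1 * w2 * M12 + w1 * w3 * M13 + w1 * w4 * M14 + w2 * w3 * M23
       + w2 * w4 * M24 + w3 * w4 * M34)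
  <= w1 ^+ 2 * (2 * c * r1 + h1 ^+ 2) + w2 ^+ 2 * (2 * c * r2 + h2 ^+ 2)
   + w3 ^+ 2 * (2 * c * r3 + h3 ^+ 2) + w4 ^+ 2 * (2 * c * r4 + h4 ^+ 2).
Proof.
pose large (h r : R) : bool := h <= r.
(* [share] is the part of the AM-GM bound for a pair charged to one index.
   These shares suffice unless exactly one index is large; then [lone] is used
   for the three pairs containing it. *)
pose share (b b' : bool) (h r : R) : R :=
  if b then if b' then h ^+ 2 else h * r else if b' then h * r else r ^+ 2.
have pair (h h' r r' w w' M : R) : 0 <= h <= c -> 0 <= h' <= c -> 0 <= r -> 0 <= r' ->
    0 <= w -> 0 <= w' -> M <= h * h' -> M <= r * r' ->
    2 * (w * w' * M) <= w ^+ 2 * share (large h r) (large h' r') h r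
                      + w' ^+ 2 * share (large h' r') (large h r) h' r'.
  move=> /andP[h0 hc] /andP[h'0 h'c] r0 r'0 w0 w'0 Mh Mr; apply: weighted_amgm => //.
  - by rewrite /share; case: (large h r); case: (large h' r'); rewrite ?mulr_ge0 ?sqr_ge0.
  - by rewrite /share; case: (large h r); case: (large h' r'); rewrite ?mulr_ge0 ?sqr_ge0.
  move=> M0; rewrite /share; case: (large h r); case: (large h' r'); rewrite -?exprMn.
  - by rewrite ler_pXn2r // nnegrE mulr_ge0.
  - by rewrite mulrACA expr2 ler_pM.
  - by rewrite mulrACA expr2 ler_pM.
  - by rewrite ler_pXn2r // nnegrE mulr_ge0.
have lone (h h' r r' w w' M : R) : 0 <= h <= c -> 0 <= h' <= c -> 0 <= r -> 0 <= r' ->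
    0 <= w -> 0 <= w' -> M <= h * h' -> M <= r * r' ->
    large h r && ~~ large h' r' ->
    2 * (w * w' * M) <= w ^+ 2 * ((2 * c * r + h ^+ 2) / 3)
                      + w' ^+ 2 * (2 * c * r' + h' ^+ 2 - 2 * r' ^+ 2).
  move=> /andP[h0 hc] /andP[h'0 h'c] r0 r'0 w0 w'0 Mh Mr.
  rewrite /large -ltNge => /andP[hr /ltW rh']; have c0 := le_trans h0 hc.
  apply: weighted_amgm => //.
  - by rewrite divr_ge0 // addr_ge0 ?mulr_ge0 ?sqr_ge0.
  - have := ler_wpM2r r'0 (le_trans rh' h'c).
    have : r' ^+ 2 <= h' ^+ 2 by rewrite ler_pXn2r.
    by have := sqr_ge0 r'; lra.
  by move=> M0; apply: lone_large_sqr_le.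
have own (h r w : R) : 0 <= h <= c -> 0 <= r -> 
    [/\ w ^+ 2 * (h * r) <= w ^+ 2 * (c * r),
     large h r -> w ^+ 2 * h ^+ 2 <= w ^+ 2 * (h * r),
     ~~ large h r -> w ^+ 2 * (h * r) <= w ^+ 2 * h ^+ 2 &
     ~~ large h r -> w ^+ 2 * r ^+ 2 <= w ^+ 2 * (h * r)].
  move=> /andP[h0 hc] r0; rewrite /large -ltNge; split.
  - by rewrite ler_wpM2l ?sqr_ge0 // ler_wpM2r.
  - by move=> hr; rewrite ler_wpM2l ?sqr_ge0 // expr2 ler_wpM2l.
  - by move=> /ltW hr; rewrite ler_wpM2l ?sqr_ge0 // expr2 ler_wpM2l.
  - by move=> /ltW hr; rewrite ler_wpM2l ?sqr_ge0 // expr2 ler_wpM2r.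
move=> H1 H2 H3 H4 R1 R2 R3 R4 W1 W2 W3 W4 M12h M12r M13h M13r M14h M14r M23h M23r
  M24h M24r M34h M34r.
have swap h h' (M : R) : M <= h * h' -> M <= h' * h by rewrite mulrC.
have E1 := pair _ _ _ _ _ _ _ H1 H2 R1 R2 W1 W2 M12h M12r.
have E2 := pair _ _ _ _ _ _ _ H1 H3 R1 R3 W1 W3 M13h M13r.
have E3 := pair _ _ _ _ _ _ _ H1 H4 R1 R4 W1 W4 M14h M14r.
have E4 := pair _ _ _ _ _ _ _ H2 H3 R2 R3 W2 W3 M23h M23r.
have E5 := pair _ _ _ _ _ _ _ H2 H4 R2 R4 W2 W4 M24h M24r.
have E6 := pair _ _ _ _ _ _ _ H3 H4 R3 R4 W3 W4 M34h M34r.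
have [E7 o1 o2 o3] := own _ _ w1 H1 R1; have [E8 o4 o5 o6] := own _ _ w2 H2 R2.
have [E9 o7 o8 o9] := own _ _ w3 H3 R3; have [E10 o10 o11 o12] := own _ _ w4 H4 R4.
move: o1 o2 o3 o4 o5 o6 o7 o8 o9 o10 o11 o12.
have := lone _ _ _ _ _ _ _ H1 H2 R1 R2 W1 W2 M12h M12r.
have := lone _ _ _ _ _ _ _ H1 H3 R1 R3 W1 W3 M13h M13r.
have := lone _ _ _ _ _ _ _ H1 H4 R1 R4 W1 W4 M14h M14r.
have := lone _ _ _ _ _ _ _ H2 H3 R2 R3 W2 W3 M23h M23r.
have := lone _ _ _ _ _ _ _ H2 H4 R2 R4 W2 W4 M24h M24r.
have := lone _ _ _ _ _ _ _ H3 H4 R3 R4 W3 W4 M34h M34r.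
have := lone _ _ _ _ _ _ _ H2 H1 R2 R1 W2 W1 (swap _ _ _ M12h) (swap _ _ _ M12r).
have := lone _ _ _ _ _ _ _ H3 H1 R3 R1 W3 W1 (swap _ _ _ M13h) (swap _ _ _ M13r).
have := lone _ _ _ _ _ _ _ H4 H1 R4 R1 W4 W1 (swap _ _ _ M14h) (swap _ _ _ M14r).
have := lone _ _ _ _ _ _ _ H3 H2 R3 R2 W3 W2 (swap _ _ _ M23h) (swap _ _ _ M23r).
have := lone _ _ _ _ _ _ _ H4 H2 R4 R2 W4 W2 (swap _ _ _ M24h) (swap _ _ _ M24r).
have := lone _ _ _ _ _ _ _ H4 H3 R4 R3 W4 W3 (swap _ _ _ M34h) (swap _ _ _ M34r).
move: E1 E2 E3 E4 E5 E6; rewrite {pair lone own swap}/share.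
(* Next to another large index, the shares of a large index sum to at most [h ^+ 2 + 2 * h * r];
   those of a small index sum to at most [3 * h * r], which is no more. Both fit into
   [h ^+ 2 + 2 * c * r]. *)
case: (large h1 r1); case: (large h2 r2); case: (large h3 r3); case: (large h4 r4) => /=;
move: E7 E8 E9 E10;
move=> {H1 H2 H3 H4 R1 R2 R3 R4 W1 W2 W3 W4 M12h M12r M13h M13r M14h M14r M23h M23r
  M24h M24r M34h M34r} E7 E8 E9 E10 E1 E2 E3 E4 E5 E6;
(* Of the twelve [lone] and twelve conditional [own] facts, those whose condition holds in the
   current case are kept. *)
do 24![move=> /(_ isT) ? | move=> _]; lra.
Qed.
End FourWeights.

(** * Ptolemaic distance functions and the sign patterns 1+5 and 2+4 *)

Section TriangleAndPtolemy.
Variable R : rcfType.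

Record ptolemaic_dist (T : Type) (d : T -> T -> R) : Prop := PtolemaicDist {
  pd_ge0 : forall x y, 0 <= d x y;
  pd_xx : forall x, d x x = 0;
  pd_sym : forall x y, d x y = d y x;
  pd_tri : forall x y z, d x z <= d x y + d y z;
  pd_ptol : forall x y z w, d x y * d z w <= d x z * d y w + d x w * d y z }.

Variables (T : Type) (d : T -> T -> R).
Hypothesis pd : ptolemaic_dist d.

(** Going through [x] bounds each pair; the terms [w_i ^+ 2 * d x y_i] are left over. *)
Lemma one_five_le (x y1 y2 y3 y4 y5 : T) (w1 w2 w3 w4 w5 : R) :
  0 <= w1 -> 0 <= w2 -> 0 <= w3 -> 0 <= w4 -> 0 <= w5 ->
  w1 * w2 * d y1 y2 + w1 * w3 * d y1 y3 + w1 * w4 * d y1 y4 + w1 * w5 * d y1 y5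
  + w2 * w3 * d y2 y3 + w2 * w4 * d y2 y4 + w2 * w5 * d y2 y5
  + w3 * w4 * d y3 y4 + w3 * w5 * d y3 y5 + w4 * w5 * d y4 y5
  <= (w1 + w2 + w3 + w4 + w5) * (w1 * d x y1 + w2 * d x y2 + w3 * d x y3
      + w4 * d x y4 + w5 * d x y5).
Proof.
move=> p1 p2 p3 p4 p5.
have tri a b y z : 0 <= a -> 0 <= b -> a * b * d y z <= a * b * (d x y + d x z).
  by move=> a0 b0; rewrite ler_wpM2l ?mulr_ge0 // (pd_sym pd x y) (pd_tri pd).
have := tri _ _ y1 y2 p1 p2; have := tri _ _ y1 y3 p1 p3.
have := tri _ _ y1 y4 p1 p4; have := tri _ _ y1 y5 p1 p5.
have := tri _ _ y2 y3 p2 p3; have := tri _ _ y2 y4 p2 p4.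
have := tri _ _ y2 y5 p2 p5; have := tri _ _ y3 y4 p3 p4.
have := tri _ _ y3 y5 p3 p5; have := tri _ _ y4 y5 p4 p5.
have sq w y : 0 <= w ^+ 2 * d x y by rewrite mulr_ge0 ?sqr_ge0 ?(pd_ge0 pd).
have := sq w1 y1; have := sq w2 y2; have := sq w3 y3; have := sq w4 y4.
have := sq w5 y5; lra.
Qed.

Lemma two_four_le (a b y1 y2 y3 y4 : T) (p q w1 w2 w3 w4 : R) :
  0 <= w1 -> 0 <= w2 -> 0 <= w3 -> 0 <= w4 -> p + q = w1 + w2 + w3 + w4 ->
  p * q * d a b + (w1 * w2 * d y1 y2 + w1 * w3 * d y1 y3 + w1 * w4 * d y1 y4
    + w2 * w3 * d y2 y3 + w2 * w4 * d y2 y4 + w3 * w4 * d y3 y4)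
  <= p * (w1 * d a y1 + w2 * d a y2 + w3 * d a y3 + w4 * d a y4)
   + q * (w1 * d b y1 + w2 * d b y2 + w3 * d b y3 + w4 * d b y4).
Proof.
move=> p1 p2 p3 p4 pq; have c0 := pd_ge0 pd a b.
have tab y : d a y <= d a b + d b y := pd_tri pd a b y.
have tba y : d b y <= d a b + d a y by rewrite (pd_sym pd a b) (pd_tri pd).
have [cE|c_neq0] := eqVneq (d a b) 0.
  have E y : d b y = d a y.
    by apply/eqP; rewrite eq_le; have := tab y; have := tba y;
      rewrite cE !add0r => -> ->.
  have := @one_five_le a y1 y2 y3 y4 y4 w1 w2 w3 w4 0 p1 p2 p3 p4 (lexx _).
  by rewrite !E cE -mulrDl pq; lra.
have c_gt0 : 0 < d a b by rewrite lt_def c_neq0.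
pose h y := Num.sqrt (d a b ^+ 2 - (d a y - d b y) ^+ 2).
pose r y := d a y + d b y - d a b.
pose t y := d a y - d b y.
(* Multiply the difference of the two sides by [4 * d a b] and complete the square in [p]: the
   product of the weights of [y] and [z] then has coefficient [- 2 * M y z], and the square of the
   weight of [y] has [2 * d a b * r y + h y ^+ 2]. *)
pose M y z := 2 * d a b * d y z - (d a b * (d a y + d b y)
  + d a b * (d a z + d b z) - d a b ^+ 2 - t y * t z).
have tl y : 0 <= d a b - t y by rewrite /t; have := tab y; lra.
have tr y : 0 <= d a b + t y by rewrite /t; have := tba y; lra.
have h2 y : h y ^+ 2 = d a b ^+ 2 - t y ^+ 2.
  by rewrite sqr_sqrtr // -/(t y) subr_sqr mulr_ge0.
have hc y : 0 <= h y <= d a b.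
  rewrite sqrtr_ge0 -[leRHS](ger0_norm c0) -sqrtr_sqr ler_wsqrtr //.
  by rewrite gerBl sqr_ge0.
have r0 y : 0 <= r y.
  by rewrite subr_ge0 (pd_sym pd b y) (pd_tri pd).
(* With [c = d a b], the triangle inequality through [b] gives [M y z <= (c - t y) * (c - t z)], and
   the one through [a] gives the same with plus signs; multiply the two. *)
have Mh y z : M y z <= h y * h z.
  case: (lerP (M y z) 0) => M0.
    by apply: le_trans M0 _; rewrite mulr_ge0 ?sqrtr_ge0.
  rewrite -(@ler_pXn2r _ 2) ?nnegrE ?mulr_ge0 ?sqrtr_ge0 ?(ltW M0) //.
  rewrite exprMn !h2 !subr_sqr mulrACA expr2 ler_pM ?(ltW M0) //.
    have /(ler_wpM2l c0) : d y z <= d b y + d b z.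
      by rewrite (pd_sym pd b y) (pd_tri pd).
    by rewrite /M /t; lra.
  have /(ler_wpM2l c0) : d y z <= d a y + d a z.
    by rewrite (pd_sym pd a y) (pd_tri pd).
  by rewrite /M /t; lra.
have Mr y z : M y z <= r y * r z.
  by have := pd_ptol pd a b y z; rewrite /M /r /t; lra.
have := @four_weights_bound _ (d a b) _ _ _ _ _ _ _ _ w1 w2 w3 w4 _ _ _ _ _ _
  (hc y1) (hc y2) (hc y3) (hc y4) (r0 y1) (r0 y2) (r0 y3) (r0 y4) p1 p2 p3 p4
  (Mh y1 y2) (Mr y1 y2) (Mh y1 y3) (Mr y1 y3) (Mh y1 y4) (Mr y1 y4)
  (Mh y2 y3) (Mr y2 y3) (Mh y2 y4) (Mr y2 y4) (Mh y3 y4) (Mr y3 y4).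
rewrite !h2 /M /r => F.
(* The completed square in [p]. *)
have G := sqr_ge0 (d a b * (2 * p - (w1 + w2 + w3 + w4))
                   + (w1 * t y1 + w2 * t y2 + w3 * t y3 + w4 * t y4)).
have -> : q = w1 + w2 + w3 + w4 - p by rewrite -pq; ring.
by rewrite -(ler_pM2l c_gt0); move: F G; rewrite /t; lra.
Qed.

End TriangleAndPtolemy.

(** * Three points against three *)

Section ThreeThree.
Variables (R : rcfType) (T : eqType) (d : T -> T -> R).
Hypothesis pd : ptolemaic_dist d.

(* With the point at infinity added, the triangle inequality becomes an
   instance of Ptolemy's inequality. *)
Definition with_infty (i k : option T) : R :=
  match i, k with
  | None, None => 0
  | Some x, Some y => d x y
  | _, _ => 1
  end.

Lemma with_infty_ge0 i k : 0 <= with_infty i k.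
Proof. by case: i k => [x|] [y|] //=; apply: (pd_ge0 pd). Qed.

Lemma with_infty_sym i k : with_infty i k = with_infty k i.
Proof. by case: i k => [x|] [y|] //=; apply: (pd_sym pd). Qed.

Lemma with_infty_ptol i j k l :
  with_infty i j * with_infty k l
  <= with_infty i k * with_infty j l + with_infty i l * with_infty j k.
Proof.
have sy := pd_sym pd; have tr := pd_tri pd; have ge := pd_ge0 pd.
case: i j k l => [x|] [y|] [z|] [w|] /=; rewrite ?(mul0r, mulr0, mul1r, mulr1,
  add0r, addr0) ?(addr_ge0 ler01) ?ler01 //; try exact: (pd_ptol pd).
- by rewrite (sy y z).
- by rewrite (sy y w) addrC.
- by rewrite (sy x z).
- by rewrite (sy y z) addrC.
Qed.

(** Coordinates of a point with respect to infinity and the three [x_i]. Eliminating [c0] and [c1]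
    leaves a 2 by 2 system whose determinant is 16 times the squared area of the triangle with
    squared sides [a12, a13, a23]. *)
Lemma solve_rows (a12 a13 a23 p1 p2 p3 : R) :
  a12 < a13 + a23 -> a13 < a12 + a23 -> a23 < a12 + a13 ->
  exists c : R * R * R * R, let: (c0, c1, c2, c3) := c in
  [/\ c1 + c2 + c3 = 1,
      p1 = c0 + c2 * a12 + c3 * a13,
      p2 = c0 + c1 * a12 + c3 * a23 &
      p3 = c0 + c1 * a13 + c2 * a23].
Proof.
move=> t12 t13 t23; pose r := a12 + a13 - a23.
have H0 : 4 * a12 * a13 - r ^+ 2 != 0.
  rewrite gt_eqF // subr_gt0 expr2.
  have -> : 4 * a12 * a13 = (2 * a12) * (2 * a13) by ring.
  by apply: ltr_pM; rewrite /r; lra.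
pose c2 := (2 * a13 * (p1 - p2 + a12) - r * (p1 - p3 + a13)) /
  (4 * a12 * a13 - r ^+ 2).
pose c3 := (2 * a12 * (p1 - p3 + a13) - r * (p1 - p2 + a12)) /
  (4 * a12 * a13 - r ^+ 2).
exists (p1 - c2 * a12 - c3 * a13, 1 - c2 - c3, c2, c3).
by split; rewrite /c2 /c3; move: H0; rewrite /r => H0; try ring; field.
Qed.

(** The strict triangle inequalities make the Gram matrix of infinity and the [x_i] invertible; the
    hypothesis on affine weights puts each [y_i] at positive height over the plane. *)
Lemma three_three_le (x1 x2 x3 y1 y2 y3 : T) (u1 u2 u3 v1 v2 v3 : R) :
  0 < d x1 x2 -> 0 < d x1 x3 -> 0 < d x2 x3 ->
  d x1 x2 < d x1 x3 + d x2 x3 -> d x1 x3 < d x1 x2 + d x2 x3 ->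
  d x2 x3 < d x1 x2 + d x1 x3 ->
  (forall y c1 c2 c3, y \in [:: y1; y2; y3] -> c1 + c2 + c3 = 1 ->
     c1 * c2 * d x1 x2 + c1 * c3 * d x1 x3 + c2 * c3 * d x2 x3
     < c1 * d x1 y + c2 * d x2 y + c3 * d x3 y) ->
  0 <= v1 -> 0 <= v2 -> 0 <= v3 -> u1 + u2 + u3 = v1 + v2 + v3 ->
  u1 * u2 * d x1 x2 + u1 * u3 * d x1 x3 + u2 * u3 * d x2 x3
  + (v1 * v2 * d y1 y2 + v1 * v3 * d y1 y3 + v2 * v3 * d y2 y3)
  <= u1 * (v1 * d x1 y1 + v2 * d x1 y2 + v3 * d x1 y3)
   + u2 * (v1 * d x2 y1 + v2 * d x2 y2 + v3 * d x2 y3)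
   + u3 * (v1 * d x3 y1 + v2 * d x3 y2 + v3 * d x3 y3).
Proof.
move=> D12 D13 D23 t12 t13 t23 pos v1_ge0 v2_ge0 v3_ge0 uv.
have sol y := solve_rows (d x1 y) (d x2 y) (d x3 y) t12 t13 t23.
have [[[[a0 a1] a2] a3] [a_sum a_1 a_2 a_3]] := sol y1.
have [[[[b0 b1] b2] b3] [b_sum b_1 b_2 b_3]] := sol y2.
have [[[[c0 c1] c2] c3] [c_sum c_1 c_2 c_3]] := sol y3.
pose N e0 e1 e2 e3 y := e0 * 1 + e1 * d x1 y + e2 * d x2 y + e3 * d x3 y.
have s21 := pd_sym pd x2 x1; have s31 := pd_sym pd x3 x1.
have s32 := pd_sym pd x3 x2.
have N_gt0 e0 e1 e2 e3 y : y \in [:: y1; y2; y3] -> e1 + e2 + e3 = 1 ->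
    d x1 y = e0 + e2 * d x1 x2 + e3 * d x1 x3 ->
    d x2 y = e0 + e1 * d x1 x2 + e3 * d x2 x3 ->
    d x3 y = e0 + e1 * d x1 x3 + e2 * d x2 x3 -> 0 < N e0 e1 e2 e3 y.
  move=> yin es r1 r2 r3; have := pos _ _ _ _ yin es.
  have : e1 * d x1 y + e2 * d x2 y + e3 * d x3 y = e0 * (e1 + e2 + e3) +
    2 * (e1 * e2 * d x1 x2 + e1 * e3 * d x1 x3 + e2 * e3 * d x2 x3).
    by rewrite r1 r2 r3; ring.
  by rewrite /N es; lra.
have five y z e0 e1 e2 e3 g0 g1 g2 g3 :
    y \in [:: y1; y2; y3] -> z \in [:: y1; y2; y3] ->
    e1 + e2 + e3 = 1 ->
    d x1 y = e0 + e2 * d x1 x2 + e3 * d x1 x3 ->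
    d x2 y = e0 + e1 * d x1 x2 + e3 * d x2 x3 ->
    d x3 y = e0 + e1 * d x1 x3 + e2 * d x2 x3 ->
    g1 + g2 + g3 = 1 ->
    d x1 z = g0 + g2 * d x1 x2 + g3 * d x1 x3 ->
    d x2 z = g0 + g1 * d x1 x2 + g3 * d x2 x3 ->
    d x3 z = g0 + g1 * d x1 x3 + g2 * d x2 x3 ->
    d y z <= N e0 e1 e2 e3 z +
      Num.sqrt (N e0 e1 e2 e3 y) * Num.sqrt (N g0 g1 g2 g3 z) / 2.
  move=> yin zin es r1 r2 r3 gs q1 q2 q3.
  apply: (@five_point_bound _ _ with_infty with_infty_ge0 with_infty_sym
    with_infty_ptol None (Some x1) (Some x2) (Some x3) _ _ _ _ _ _
    (Some y) (Some z) e0 e1 e2 e3 g0 g1 g2 g3) => //=; rewrite ?mulr1 ?s21 ?s31 ?s32 //.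
  - exact: N_gt0.
  - exact: N_gt0.
have i1 : y1 \in [:: y1; y2; y3] by rewrite !inE eqxx.
have i2 : y2 \in [:: y1; y2; y3] by rewrite !inE eqxx orbT.
have i3 : y3 \in [:: y1; y2; y3] by rewrite !inE eqxx !orbT.
(* The product of two points appears in [gram] in both orders, so the bound is taken in both orders
   and averaged. *)
have E12 := five _ _ _ _ _ _ _ _ _ _ i1 i2 a_sum a_1 a_2 a_3 b_sum b_1 b_2 b_3.
have E21 := five _ _ _ _ _ _ _ _ _ _ i2 i1 b_sum b_1 b_2 b_3 a_sum a_1 a_2 a_3.
have E13 := five _ _ _ _ _ _ _ _ _ _ i1 i3 a_sum a_1 a_2 a_3 c_sum c_1 c_2 c_3.
have E31 := five _ _ _ _ _ _ _ _ _ _ i3 i1 c_sum c_1 c_2 c_3 a_sum a_1 a_2 a_3.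
have E23 := five _ _ _ _ _ _ _ _ _ _ i2 i3 b_sum b_1 b_2 b_3 c_sum c_1 c_2 c_3.
have E32 := five _ _ _ _ _ _ _ _ _ _ i3 i2 c_sum c_1 c_2 c_3 b_sum b_1 b_2 b_3.
have f2 e0 e1 e2 e3 y : 0 < N e0 e1 e2 e3 y ->
    Num.sqrt (N e0 e1 e2 e3 y) ^+ 2 = N e0 e1 e2 e3 y.
  by move=> /ltW ?; rewrite sqr_sqrtr.
have fa := f2 _ _ _ _ _ (N_gt0 _ _ _ _ _ i1 a_sum a_1 a_2 a_3).
have fb := f2 _ _ _ _ _ (N_gt0 _ _ _ _ _ i2 b_sum b_1 b_2 b_3).
have fc := f2 _ _ _ _ _ (N_gt0 _ _ _ _ _ i3 c_sum c_1 c_2 c_3).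
pose w0 := v1 * a0 + v2 * b0 + v3 * c0.
pose w1 := v1 * a1 + v2 * b1 + v3 * c1.
pose w2 := v1 * a2 + v2 * b2 + v3 * c2.
pose w3 := v1 * a3 + v2 * b3 + v3 * c3.
have w_sum : w1 + w2 + w3 = v1 + v2 + v3.
  rewrite -[v1]mulr1 -{1}a_sum -[v2]mulr1 -{1}b_sum -[v3]mulr1 -{1}c_sum.
  by rewrite /w1 /w2 /w3; ring.
pose S x := v1 * d x y1 + v2 * d x y2 + v3 * d x y3.
have S1 : S x1 = w0 + w2 * d x1 x2 + w3 * d x1 x3.
  by rewrite /S a_1 b_1 c_1 /w0 /w2 /w3; ring.
have S2 : S x2 = w0 + w1 * d x1 x2 + w3 * d x2 x3.
  by rewrite /S a_2 b_2 c_2 /w0 /w1 /w3; ring.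
have S3 : S x3 = w0 + w1 * d x1 x3 + w2 * d x2 x3.
  by rewrite /S a_3 b_3 c_3 /w0 /w1 /w2; ring.
(* For a fixed sum of the [u_i] the right side is stationary at [u = w], where it equals the left
   side. The remainder is minus the form at [u - w], whose weights sum to 0, that is, a vector
   orthogonal to infinity. *)
have concave : (w0 * (v1 + v2 + v3) + w1 * S x1 + w2 * S x2 + w3 * S x3) / 2
    <= u1 * S x1 + u2 * S x2 + u3 * S x3
       - (u1 * u2 * d x1 x2 + u1 * u3 * d x1 x3 + u2 * u3 * d x2 x3).
  have := @isotropic_orthogonal _ _ with_infty with_infty_ge0 with_infty_sym
    with_infty_ptol None (Some x1) (Some x2) (Some x3) 0
    (u1 - w1) (u2 - w2) (u3 - w3) ltr01.
  rewrite /= => iso.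
  have {iso} := iso ltac:(lra).
  rewrite S1 S2 S3 -uv; have -> : u1 = w1 + w2 + w3 - u2 - u3 by lra.
  by lra.
rewrite -/(S x1) -/(S x2) -/(S x3).
have {S1 S2 S3 w_sum} gram : w0 * (v1 + v2 + v3) + w1 * S x1 + w2 * S x2 + w3 * S x3
  = v1 ^+ 2 * N a0 a1 a2 a3 y1 + v2 ^+ 2 * N b0 b1 b2 b3 y2
  + v3 ^+ 2 * N c0 c1 c2 c3 y3
  + v1 * v2 * (N a0 a1 a2 a3 y2 + N b0 b1 b2 b3 y1)
  + v1 * v3 * (N a0 a1 a2 a3 y3 + N c0 c1 c2 c3 y1)
  + v2 * v3 * (N b0 b1 b2 b3 y3 + N c0 c1 c2 c3 y2).
  by rewrite /w0 /w1 /w2 /w3 /S /N; ring.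
move: concave; rewrite {}gram.
move: E12 E21 E13 E31 E23 E32; rewrite (pd_sym pd y2 y1) (pd_sym pd y3 y1)
  (pd_sym pd y3 y2).
move: fa fb fc.
move: (N a0 a1 a2 a3 y1) (N b0 b1 b2 b3 y2) (N c0 c1 c2 c3 y3).
move: (N a0 a1 a2 a3 y2) (N b0 b1 b2 b3 y1) (N a0 a1 a2 a3 y3).
move: (N c0 c1 c2 c3 y1) (N b0 b1 b2 b3 y3) (N c0 c1 c2 c3 y2).
move=> N31 N23 N32 N12 N21 N13 N11 N22 N33.
move: (Num.sqrt N11) (Num.sqrt N22) (Num.sqrt N33) => f g h <- <- <-.
move=> E12 E21 E13 E31 E23 E32.
have := ler_wpM2l (mulr_ge0 v1_ge0 v2_ge0) (lerD E12 E21).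
have := ler_wpM2l (mulr_ge0 v1_ge0 v3_ge0) (lerD E13 E31).
have := ler_wpM2l (mulr_ge0 v2_ge0 v3_ge0) (lerD E23 E32).
(* With angles of at most 120 degrees, what remains is that the squares of three numbers sum to at
   least their pairwise products. *)
have := sqr_ge0 (v1 * f - v2 * g); have := sqr_ge0 (v1 * f - v3 * h).
have := sqr_ge0 (v2 * g - v3 * h); lra.
Qed.

End ThreeThree.

(** * Perturbation to strict triangle inequalities and positive heights *)

Section Thickening.
Variables (R : rcfType) (T : eqType).

(* Makes the triangle inequalities strict, so that the Gram matrices above are
   invertible; the form of exponent 1 depends affinely on e. *)
Definition thicken (d : T -> T -> R) (e : R) (x y : T) : R :=
  d x y + e * (x != y)%:R.

(** For four distinct points the terms linear in [e] compare by adding four triangle inequalities,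
    and [e ^+ 2] occurs once on the left and twice on the right. *)
Lemma thicken_ptolemaic (d : T -> T -> R) (e : R) :
  0 <= e -> ptolemaic_dist d -> ptolemaic_dist (thicken d e).
Proof.
move=> e0 pd; have ge := pd_ge0 pd; have xx := pd_xx pd.
have sy := pd_sym pd; have tr := pd_tri pd; have pt := pd_ptol pd.
have th_xx x : thicken d e x x = 0 by rewrite /thicken eqxx xx mulr0 addr0.
have th_sy x y : thicken d e x y = thicken d e y x.
  by rewrite /thicken sy eq_sym.
have th_ge x y : 0 <= thicken d e x y by rewrite addr_ge0 // mulr_ge0 // ler0n.
have th_neq x y : x != y -> thicken d e x y = d x y + e.
  by move=> xy; rewrite /thicken xy mulr1.
split=> // [x y z|x y z w].
  have [->|xy] := eqVneq x y; first by rewrite th_xx add0r.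
  have [->|yz] := eqVneq y z; first by rewrite th_xx addr0.
  have [->|xz] := eqVneq x z; first by rewrite th_xx addr_ge0.
  by rewrite !th_neq //; have := tr x y z; lra.
have [->|xy] := eqVneq x y; first by rewrite th_xx mul0r addr_ge0 // mulr_ge0.
have [->|zw] := eqVneq z w; first by rewrite th_xx mulr0 addr_ge0 // mulr_ge0.
have [->|xz] := eqVneq x z; first by rewrite th_xx mul0r add0r mulrC (th_sy z y).
have [->|yw] := eqVneq y w; first by rewrite th_xx mulr0 add0r (th_sy w z).
have [->|xw] := eqVneq x w.
  by rewrite th_xx mul0r addr0 mulrC (th_sy y w) (th_sy z w).
have [->|yz] := eqVneq y z; first by rewrite th_xx mulr0 addr0.
rewrite !th_neq //.
have : 2 * (d x y + d z w) <= 2 * (d x z + d y w + d x w + d y z).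
  have := tr x z y; have := tr x w y; have := tr z x w; have := tr z y w.
  rewrite !(sy z x, sy w y, sy z y); lra.
rewrite ler_pM2l // => /(ler_wpM2l e0); have := pt x y z w.
have := sqr_ge0 e; lra.
Qed.

Variables (d : T -> T -> R).
Hypothesis pd : ptolemaic_dist d.

(** Negative type of four points with weight -1 at [y], used for the heights. Each sign pattern of
    the [c_i] is an instance of [one_five_le] or [two_four_le] with spare places of weight 0. *)
Lemma four_point_le (x1 x2 x3 y : T) (c1 c2 c3 : R) : c1 + c2 + c3 = 1 ->
  c1 * c2 * d x1 x2 + c1 * c3 * d x1 x3 + c2 * c3 * d x2 x3
  <= c1 * d x1 y + c2 * d x2 y + c3 * d x3 y.
Proof.
have sy := pd_sym pd.
have one_neg a b c ca cb cc : ca <= 0 -> 0 <= cb -> 0 <= cc ->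
    ca + cb + cc = 1 -> ca * cb * d a b + ca * cc * d a c + cb * cc * d b c
    <= ca * d a y + cb * d b y + cc * d c y.
  move=> a0 b0 c0 s1.
  have := @two_four_le _ _ _ pd a y b c b b (- ca) 1 cb cc 0 0 b0 c0 (lexx _) (lexx _).
  by rewrite (sy y b) (sy y c) => F; have := F ltac:(lra); lra.
have two_neg a b c ca cb cc : ca <= 0 -> cb <= 0 ->
    ca + cb + cc = 1 -> ca * cb * d a b + ca * cc * d a c + cb * cc * d b c
    <= ca * d a y + cb * d b y + cc * d c y.
  move=> a0 b0 s1; have a0' : 0 <= - ca by lra.
  have b0' : 0 <= - cb by lra.
  have := @one_five_le _ _ _ pd c a b y a a (- ca) (- cb) 1 0 0 a0' b0' ler01
    (lexx _) (lexx _).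
  have -> : cc = 1 - ca - cb by lra.
  by rewrite (sy c a) (sy c b); lra.
move=> s1; have [c1_ge0|/ltW c1_le0] := lerP 0 c1;
  have [c2_ge0|/ltW c2_le0] := lerP 0 c2; have [c3_ge0|/ltW c3_le0] := lerP 0 c3.
- have := @one_five_le _ _ _ pd y x1 x2 x3 y y c1 c2 c3 0 0 c1_ge0 c2_ge0 c3_ge0
    (lexx _) (lexx _).
  by rewrite !(sy y) addr0 addr0 s1; lra.
- by have := one_neg x3 x1 x2 c3 c1 c2; rewrite (sy x3 x1) (sy x3 x2); lra.
- by have := one_neg x2 x1 x3 c2 c1 c3; rewrite (sy x2 x1); lra.
- by have := two_neg x2 x3 x1 c2 c3 c1; rewrite (sy x2 x1) (sy x3 x1); lra.
- by apply: one_neg.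
- by have := two_neg x1 x3 x2 c1 c3 c2; rewrite (sy x3 x2); lra.
- by apply: two_neg.
- by lra.
Qed.

End Thickening.

(** * The limit of the thickened metrics and the case split on signs *)

Section SixPoints.
Variables (R : rcfType) (T : eqType) (d : T -> T -> R).
Hypothesis pd : ptolemaic_dist d.

Lemma three_three_weak_le (x1 x2 x3 y1 y2 y3 : T) (u1 u2 u3 v1 v2 v3 : R) :
  uniq [:: x1; x2; x3; y1; y2; y3] ->
  0 <= v1 -> 0 <= v2 -> 0 <= v3 -> u1 + u2 + u3 = v1 + v2 + v3 ->
  u1 * u2 * d x1 x2 + u1 * u3 * d x1 x3 + u2 * u3 * d x2 x3
  + (v1 * v2 * d y1 y2 + v1 * v3 * d y1 y3 + v2 * v3 * d y2 y3)
  <= u1 * (v1 * d x1 y1 + v2 * d x1 y2 + v3 * d x1 y3)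
   + u2 * (v1 * d x2 y1 + v2 * d x2 y2 + v3 * d x2 y3)
   + u3 * (v1 * d x3 y1 + v2 * d x3 y2 + v3 * d x3 y3).
Proof.
rewrite /= !inE !negb_or -!andbA.
case/and5P=> n12 n13 m11 m12 /and5P[m13 n23 m21 m22 /and5P[m23 m31 m32 m33]].
case/and4P=> k12 k13 k23 _ v1_ge0 v2_ge0 v3_ge0 uv.
have sy := pd_sym pd; have ge := pd_ge0 pd; have tr := pd_tri pd.
apply/ler_addgt0Pr => t t0.
(* Thickening by [e] changes the difference of the two sides by exactly [e * C]. *)
pose C : R := (u1 + u2 + u3) * (v1 + v2 + v3) - (u1 * u2 + u1 * u3 + u2 * u3)
  - (v1 * v2 + v1 * v3 + v2 * v3).
have C0 : 0 <= C.
  have -> : C = (u1 ^+ 2 + u2 ^+ 2 + u3 ^+ 2 + v1 ^+ 2 + v2 ^+ 2 + v3 ^+ 2) / 2.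
    have := congr1 (fun x => x ^+ 2) uv; have := congr1 ( *%R (u1 + u2 + u3)) uv.
    rewrite /C /=; lra.
  by rewrite divr_ge0 // !addr_ge0 // sqr_ge0.
pose e := t / (C + 1).
have e0 : 0 < e by rewrite divr_gt0 // ltr_wpDl.
have eC : e * C <= t.
  by rewrite /e mulrAC ler_pdivrMr ?ltr_wpDl // ler_pM2l // lerDl.
have th_neq x y : x != y -> thicken d e x y = d x y + e.
  by move=> xy; rewrite /thicken xy mulr1.
have := @three_three_le _ _ _ (thicken_ptolemaic (ltW e0) pd) x1 x2 x3 y1 y2 y3
  u1 u2 u3 v1 v2 v3.
rewrite !th_neq // => F.
suff : e * C <= t -> u1 * u2 * (d x1 x2 + e) + u1 * u3 * (d x1 x3 + e)
  + u2 * u3 * (d x2 x3 + e) + (v1 * v2 * (d y1 y2 + e)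
  + v1 * v3 * (d y1 y3 + e) + v2 * v3 * (d y2 y3 + e))
  <= u1 * (v1 * (d x1 y1 + e) + v2 * (d x1 y2 + e) + v3 * (d x1 y3 + e))
  + u2 * (v1 * (d x2 y1 + e) + v2 * (d x2 y2 + e) + v3 * (d x2 y3 + e))
  + u3 * (v1 * (d x3 y1 + e) + v2 * (d x3 y2 + e) + v3 * (d x3 y3 + e)).
  by move=> /(_ eC); move: eC; rewrite /C; lra.
have pos x y : 0 < d x y + e by rewrite ltr_wpDl.
move=> _; apply: F => //.
- by have := tr x1 x3 x2; rewrite (sy x3 x2); lra.
- by have := tr x1 x2 x3; lra.
- by have := tr x2 x1 x3; rewrite (sy x2 x1); lra.
move=> y c1 c2 c3 yin cs.
(* For weights of sum 1 the pairwise products sum to at most 1/2, so thickening makes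
   [four_point_le] strict. *)
have c_lt : e * (c1 * c2 + c1 * c3 + c2 * c3) < e * (c1 + c2 + c3).
  rewrite ltr_pM2l // cs.
  have : (c1 + c2 + c3) ^+ 2 = 1 by rewrite cs expr1n.
  have := sqr_ge0 c1; have := sqr_ge0 c2; have := sqr_ge0 c3; lra.
have := four_point_le pd x1 x2 x3 y cs.
have /and3P[z1 z2 z3] : [&& x1 != y, x2 != y & x3 != y].
  by move: yin; rewrite !inE => /or3P[] /eqP ->; apply/and3P.
by rewrite !th_neq //; lra.
Qed.

(** Since the form is unchanged under [z -> - z], the patterns 4+2 and 5+1 are 2+4 and 1+5 with the
    sides exchanged. *)
Lemma six_point_le (x1 x2 x3 x4 x5 x6 : T) (z1 z2 z3 z4 z5 z6 : R) :
  uniq [:: x1; x2; x3; x4; x5; x6] ->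
  z6 <= z5 -> z5 <= z4 -> z4 <= z3 -> z3 <= z2 -> z2 <= z1 ->
  z1 + z2 + z3 + z4 + z5 + z6 = 0 ->
  z1 * z2 * d x1 x2 + z1 * z3 * d x1 x3 + z1 * z4 * d x1 x4 + z1 * z5 * d x1 x5
  + z1 * z6 * d x1 x6 + z2 * z3 * d x2 x3 + z2 * z4 * d x2 x4
  + z2 * z5 * d x2 x5 + z2 * z6 * d x2 x6 + z3 * z4 * d x3 x4
  + z3 * z5 * d x3 x5 + z3 * z6 * d x3 x6 + z4 * z5 * d x4 x5
  + z4 * z6 * d x4 x6 + z5 * z6 * d x5 x6 <= 0.
Proof.
move=> ux o6 o5 o4 o3 o2 s0; have sy := pd_sym pd.
have [n2|/ltW p2] := lerP z2 0.
  have := @one_five_le _ _ _ pd x1 x2 x3 x4 x5 x6 (- z2) (- z3) (- z4) (- z5) (- z6).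
  have -> : - z2 - z3 - z4 - z5 - z6 = z1 by lra.
  by move=> F; have := F ltac:(lra) ltac:(lra) ltac:(lra) ltac:(lra) ltac:(lra); lra.
have [n3|/ltW p3] := lerP z3 0.
  have := @two_four_le _ _ _ pd x1 x2 x3 x4 x5 x6 z1 z2 (- z3) (- z4) (- z5) (- z6).
  by move=> F; have := F ltac:(lra) ltac:(lra) ltac:(lra) ltac:(lra) ltac:(lra); lra.
have [n4|/ltW p4] := lerP z4 0.
  have := @three_three_weak_le x1 x2 x3 x4 x5 x6 z1 z2 z3 (- z4) (- z5) (- z6) ux.
  by move=> F; have := F ltac:(lra) ltac:(lra) ltac:(lra) ltac:(lra); lra.
have [n5|/ltW p5] := lerP z5 0.
  have := @two_four_le _ _ _ pd x5 x6 x1 x2 x3 x4 (- z5) (- z6) z1 z2 z3 z4.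
  rewrite !(sy x5 x1, sy x5 x2, sy x5 x3, sy x5 x4).
  rewrite !(sy x6 x1, sy x6 x2, sy x6 x3, sy x6 x4) => F.
  by have := F ltac:(lra) ltac:(lra) ltac:(lra) ltac:(lra) ltac:(lra); lra.
have := @one_five_le _ _ _ pd x6 x1 x2 x3 x4 x5 z1 z2 z3 z4 z5.
have -> : z1 + z2 + z3 + z4 + z5 = - z6 by lra.
rewrite !(sy x6 x1, sy x6 x2, sy x6 x3, sy x6 x4, sy x6 x5) => F.
by have := F ltac:(lra) ltac:(lra) ltac:(lra) ltac:(lra) ltac:(lra); lra.
Qed.
End SixPoints.

(** * Sharpness *)

Definition k24_dist (i j : nat) : nat :=
  if i == j then 0 else if (2 <= i)%N && (2 <= j)%N then 2 else 1.

Lemma all_ord6 (P : nat -> nat -> nat -> nat -> bool) :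
  all (fun i => all (fun j => all (fun k => all (P i j k) (iota 0 6)) (iota 0 6))
    (iota 0 6)) (iota 0 6) ->
  forall i j k l : 'I_6, P i j k l.
Proof.
move=> h i j k l; have m (x : 'I_6) : val x \in iota 0 6.
  by rewrite mem_iota ltn_ord.
exact: (allP (allP (allP (allP h _ (m i)) _ (m j)) _ (m k)) _ (m l)).
Qed.

(** The phantom parameter lets the type determine the field of its metric structure. *)
Definition k24 (R : realType) : Type := 'I_6.
HB.instance Definition _ (R : realType) := Finite.on (k24 R).

Section SharpExample.
Variable R : realType.

Definition k24_mdist (i j : k24 R) : R := (k24_dist i j)%:R.

Lemma k24_xx i : k24_mdist i i = 0.
Proof. by rewrite /k24_mdist /k24_dist eqxx. Qed.

Lemma k24_eq0 i j : k24_mdist i j = 0 -> i = j.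
Proof.
rewrite /k24_mdist /k24_dist; case: eqP => [/val_inj//|_].
by case: ifP => _ /eqP; rewrite pnatr_eq0.
Qed.

Lemma k24_sym i j : k24_mdist i j = k24_mdist j i.
Proof. by rewrite /k24_mdist /k24_dist eq_sym andbC. Qed.

Lemma k24_tri j i k : k24_mdist i k <= k24_mdist i j + k24_mdist j k.
Proof.
rewrite /k24_mdist -natrD ler_nat.
by apply: (all_ord6 (P := fun i j k _ =>
  k24_dist i k <= k24_dist i j + k24_dist j k)%N _ i j k i).
Qed.

Lemma k24_ptol i j k l : k24_mdist i j * k24_mdist k l
  <= k24_mdist i k * k24_mdist j l + k24_mdist i l * k24_mdist j k.
Proof.
rewrite /k24_mdist -!natrM -natrD ler_nat.
by apply: (all_ord6 (P := fun i j k l => k24_dist i j * k24_dist k l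
  <= k24_dist i k * k24_dist j l + k24_dist i l * k24_dist j k)%N).
Qed.

HB.instance Definition _ := isMetric.Build R (k24 R) k24_xx k24_eq0 k24_sym k24_tri.

End SharpExample.

Lemma two_lt_powR (R : realType) (q : R) : 1 < q -> 2 < 2 `^ q.
Proof.
move=> q1; have -> : q = 1 + (q - 1) by rewrite addrC subrK.
rewrite powRD; last by rewrite pnatr_eq0 implybT.
rewrite powRr1 // ltr_pMr // -[X in X < _](congr1 (@^~ (q - 1)) (powR1 R)).
by rewrite gt0_ltr_powR ?subr_gt0 ?nnegrE ?ltr1n.
Qed.

Lemma k24_not_negative_type (R : realType) (q : R) :
  1 < q -> ~ negative_type (k24 R) q.
Proof.
(* With these weights the form equals 8 - 32 + 12 · 2^q = 12 (2^q - 2), which is positive for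
   [q > 1]. *)
move=> q1 /(_ (fun i : 'I_6 => if (i < 2)%N then 2 else -1)).
have q0 : q != 0 by rewrite gt_eqF // (lt_trans _ q1).
rewrite !big_ord_recl !big_ord0 /= => /(_ ltac:(lra)).
have -> i j : @mdist R (k24 R) i j = k24_mdist i j by [].
rewrite /k24_mdist /k24_dist /=.
rewrite !powR1 !(powR0 q0); have := two_lt_powR q1; lra.
Qed.

(** * Negative type of finite metric spaces and the value of the exponent *)

Lemma six_point_negative_type (R : realType) : all_ptolemaic_negative_type 6 (1 : R).
Proof.
move=> X cX pX z z0.
have pd : ptolemaic_dist (@mdist R X).
  split; [exact: mdist_ge0|exact: mdistxx|exact: metric_sym| |exact: pX].
  by move=> x y w; apply: metric_triangle.
pose s := sort (fun x y : X => z y <= z x) (enum X).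
have sz : size s = 6 by rewrite size_sort -cardE cX.
have us : uniq s by rewrite sort_uniq enum_uniq.
have ss : sorted (fun x y : X => z y <= z x) s.
  by apply: sort_sorted => x y; apply: le_total.
have sumE (F : X -> R) : \sum_x F x = \sum_(x <- s) F x.
  by rewrite -big_enum; apply: perm_big; rewrite perm_sym perm_sort.
under eq_bigr do under eq_bigr do rewrite powRr1 ?mdist_ge0 //.
rewrite sumE; under eq_bigr do rewrite sumE.
move: z0; rewrite sumE.
move: s sz us ss {sumE} => [|x1 [|x2 [|x3 [|x4 [|x5 [|x6 [|//]]]]]]] // _ ux.
rewrite /= => /and5P[le21 le32 le43 le54 /andP[le65 _]].
rewrite !(big_cons, big_nil) !mdistxx => z0.
have := six_point_le pd ux le65 le54 le43 le32 le21 ltac:(lra).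
rewrite !(metric_sym x2 x1, metric_sym x3 x1, metric_sym x4 x1, metric_sym x5 x1,
  metric_sym x6 x1, metric_sym x3 x2, metric_sym x4 x2, metric_sym x5 x2,
  metric_sym x6 x2, metric_sym x4 x3, metric_sym x5 x3, metric_sym x6 x3,
  metric_sym x5 x4, metric_sym x6 x4, metric_sym x6 x5).
lra.
Qed.

Theorem theorem9p1 (R : realType) :
  [/\ all_ptolemaic_negative_type 6 (1 : R),
      forall q : R, 1 < q -> ~ all_ptolemaic_negative_type 6 q
    & ptolemaic_exponent R 6 = 1%E].
Proof.
have sharp (q : R) : 1 < q -> ~ all_ptolemaic_negative_type 6 q.
  move=> q1 /(_ (k24 R)) h; apply: (k24_not_negative_type q1); apply: h.
    exact: card_ord.
  exact: k24_ptol.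
split; [exact: six_point_negative_type|exact: sharp|].
apply/eqP; rewrite eq_le; apply/andP; split.
  apply: ge_ereal_sup => _ [q [_ hq] <-]; rewrite lee_fin leNgt.
  by apply/negP => /sharp.
apply: ereal_sup_ubound; exists 1 => //; split; first exact: ltr01.
exact: six_point_negative_type.
Qed.
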